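(* Let $(X,p)$ be a $0$-complete partial $b$-metric space with coefficient $s\geq1$, $X$ nonempty, and let $T:X\to X$ be a self mapping such that for all $x,y\in X$ $$p(Tx,Ty)\leq\lambda_1p(x,y)+\lambda_2\frac{p(x,Tx)p(y,Ty)}{1+p(x,y)}+\lambda_3\frac{p(x,Ty)p(y,Tx)}{1+p(x,y)}+\lambda_4\frac{p(x,Tx)p(x,Ty)}{1+p(x,y)}+\lambda_5\frac{p(y,Ty)p(y,Tx)}{1+p(x,y)},$$ where $\lambda_1,\lambda_2,\lambda_3,\lambda_4,\lambda_5$ are nonnegative real numbers satisfying $$\lambda_1+\lambda_2+2s\lambda_3+s\lambda_4+s\lambda_5<1.$$ Then $T$ has a unique fixed point $u$ in $X$, and $p(u,u)=0$.
   Context: A partial $b$-metric space with coefficient $s\geq1$ is a pair $(X,p)$ where $X$ is a set and $p:X\times X\to[0,\infty)$ satisfies: (pm1) for all $x,y\in X$, $x=y$ if and only if $p(x,x)=p(x,y)=p(y,y)$; (pm2) $0\leq p(x,x)\leq p(x,y)$ for all $x,y\in X$; (pm3) $p(x,y)=p(y,x)$ for all $x,y\in X$; (pm4) $p(x,y)+p(z,z)\leq s[p(x,z)+p(z,y)]$ for all $x,y,z\in X$. A sequence $(x_n)_{n\ge1}$ in $X$ is $0$-Cauchy if $\lim_{n,m\to\infty}p(x_n,x_m)=0$. $(X,p)$ is $0$-complete if for every $0$-Cauchy sequence $(x_n)_{n\ge1}$ in $X$ there exists $x\in X$ with $\lim_{n,m\to\infty}p(x_n,x_m)=\lim_{n\to\infty}p(x_n,x)=p(x,x)=0$.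 *)

(* Defs.v *)
From HB Require Import structures.
From mathcomp Require Import all_boot all_order all_algebra.
From mathcomp Require Import all_classical all_reals topology normedtype.
From mathcomp Require Import sequences.

Set Implicit Arguments.
Unset Strict Implicit.
Unset Printing Implicit Defensive.

Import Order.TTheory GRing.Theory Num.Theory.
Import numFieldNormedType.Exports.

Local Open Scope classical_set_scope.
Local Open Scope ring_scope.

(* [pbm_ge0] records that [p] takes its values in [0, +oo[. *)
Record partial_bmetric (R : realType) (X : Type) (s : R) (p : X -> X -> R)
    : Prop := PartialBMetric {
  pbm_ge0 : forall x y, 0 <= p x y;
  pbm_eq : forall x y, x = y <-> p x x = p x y /\ p x y = p y y;
  pbm_self : forall x y, 0 <= p x x /\ p x x <= p x y;
  pbm_sym : forall x y, p x y = p y x;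
  pbm_triangle : forall x y z, p x y + p z z <= s * (p x z + p z y)
}.

(* Sequences are indexed from 0 rather than 1; [(\oo, \oo)] is the product
   filter, so this is the joint limit as both indices tend to infinity. *)
Definition zero_cauchy (R : realType) (X : Type) (p : X -> X -> R)
    (x_ : nat -> X) : Prop :=
  p (x_ nm.1) (x_ nm.2) @[nm --> (\oo, \oo)] --> (0 : R).

Definition zero_complete (R : realType) (X : Type) (p : X -> X -> R) : Prop :=
  forall x_ : nat -> X, zero_cauchy p x_ ->
    exists x : X,
      [/\ p (x_ nm.1) (x_ nm.2) @[nm --> (\oo, \oo)] --> (0 : R),
          p (x_ n) x @[n --> \oo] --> (0 : R)
        & p x x = 0].

(* Main.v *)
(** The Picard iterates [x_n = T^n x_0] satisfy [d_(n+1) <= k d_n] for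
    [d_n = p (x_n, x_(n+1))] and some [k < 1]: apply the contractive condition
    to [(x_n, x_(n+1))] and to [(x_(n+1), x_n)] and add, which replaces
    [l4] and [l5] by their mean, and keep the term [p (z, z)] of (pm4); without
    it this estimate would need [s + 1 / 2] in place of [s] as the coefficient
    of [l4 + l5].  Geometric decay of [d_n] implies 0-Cauchyness for every
    [k < 1], not just for [k < 1 / s]: one jumps by blocks of [N] indices, where
    [s k^N <= 1 / 2]. *)
Require Import Defs.
From mathcomp Require Import all_boot all_order all_algebra.
From mathcomp Require Import all_classical all_reals.
From mathcomp Require Import topology normedtype sequences.
From mathcomp Require Import lra.

Import Order.TTheory GRing.Theory Num.Theory.
Import numFieldNormedType.Exports.
Local Open Scope ring_scope.

Lemma divr_le_factor (R : realFieldType) (q x y : R) :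
  0 <= q -> x <= 1 + q -> 0 <= y -> x * y / (1 + q) <= y.
Proof.
move=> q0 xq y0; have q1 : 0 < 1 + q by lra.
by rewrite ler_pdivrMr // mulrC ler_wpM2l.
Qed.

Lemma divr_le_prod (R : realFieldType) (q x y : R) :
  0 <= q -> 0 <= x -> 0 <= y -> x * y / (1 + q) <= x * y.
Proof.
move=> q0 x0 y0; have q1 : 0 < 1 + q by lra.
by rewrite ler_pdivrMr // ler_peMr ?mulr_ge0 //; lra.
Qed.

(* With [x], [y = T x] consecutive iterates: [a = p (x, y)], [b = p (y, T y)],
   [c = p (x, T y)], [e = p (y, y)]. *)
Lemma orbit_step (R : realFieldType) (s l1 l2 l3 l4 l5 a b c e : R) :
  1 <= s -> 0 <= l1 -> 0 <= l2 -> 0 <= l3 -> 0 <= l4 -> 0 <= l5 ->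
  l1 + l2 + 2 * s * l3 + s * l4 + s * l5 < 1 ->
  0 <= a -> 0 <= b -> 0 <= c -> 0 <= e -> e <= a -> e <= b ->
  c + e <= s * (a + b) ->
  b <= l1 * a + l2 * ((a * b) / (1 + a)) + l3 * ((c * e) / (1 + a))
     + l4 * ((a * c) / (1 + a)) + l5 * ((b * e) / (1 + a)) ->
  b <= l1 * a + l2 * ((b * a) / (1 + a)) + l3 * ((e * c) / (1 + a))
     + l4 * ((b * e) / (1 + a)) + l5 * ((a * c) / (1 + a)) ->
  (1 - l2 - s * l3 - s * (l4 + l5) / 2) * b
    <= (l1 + s * l3 + s * (l4 + l5) / 2) * a.
Proof.
move=> s1 l1p l2p l3p l4p l5p hl a0 b0 c0 e0 ea eb ce.
rewrite (mulrC b a) (mulrC c e) => h1 h2.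
have a1 : 0 < 1 + a by lra.
have hab : l2 * ((a * b) / (1 + a)) <= l2 * b.
  by rewrite ler_wpM2l // divr_le_factor //; lra.
have hec : l3 * ((e * c) / (1 + a)) <= l3 * (s * (a + b)).
  rewrite ler_wpM2l //; apply: (@le_trans _ _ c); last by lra.
  by apply: divr_le_factor => //; lra.
(* Adding the two contractive bounds gives [l4 + l5] times the sum treated here. Its numerator
   [a * c + b * e] equals [a * (c + e) + (b - a) * e], so the full (pm4) bounds the first summand;
   [m] absorbs the second, with [m = 0] if [b <= a] and [m = b - a] otherwise. *)
have key m : (b - a) * e <= a * m -> 0 <= s * (a + b) + m ->
    (l4 + l5) * ((a * c) / (1 + a) + (b * e) / (1 + a))
      <= (l4 + l5) * (s * (a + b) + m).
  move=> hm m0; rewrite ler_wpM2l ?addr_ge0 // -mulrDl.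
  apply: (@le_trans _ _ (a * (s * (a + b) + m) / (1 + a))).
    rewrite ler_wpM2r ?invr_ge0 ?(ltW a1) //.
    have : a * (c + e) <= a * (s * (a + b)) by rewrite ler_wpM2l.
    lra.
  by apply: divr_le_factor => //; lra.
have sab : 0 <= s * (a + b) by rewrite mulr_ge0 //; lra.
case: (lerP b a) => [ba|ab].
  have := key 0; rewrite mulr0 addr0.
  have ne : (b - a) * e <= 0 by rewrite mulr_le0_ge0 //; lra.
  by move=> /(_ ne sab) hk; lra.
have hm : (b - a) * e <= a * (b - a) by rewrite mulrC ler_wpM2r //; lra.
have sm : 0 <= s * (a + b) + (b - a) by lra.
have hk := key (b - a) hm sm.
(* Here [b > a], which the coefficient condition excludes. *)
have L0 : 0 <= l4 + l5 by lra.
have e1 : l1 * a <= l1 * b by rewrite ler_wpM2l // ltW.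
have e3 : l3 * (s * (a + b)) <= l3 * (s * (2 * b)).
  by rewrite !ler_wpM2l //; lra.
(* The two factors differ by [(s - 1) * (b - a)]. *)
have e4 : (l4 + l5) * (s * (a + b) + (b - a)) <= (l4 + l5) * (s * (2 * b)).
  rewrite ler_wpM2l //.
  have : 0 <= (s - 1) * (b - a) by rewrite mulr_ge0 //; lra.
  lra.
have : (l1 + l2 + 2 * s * l3 + s * l4 + s * l5) * b < 1 * b.
  by rewrite ltr_pM2r //; lra.
lra.
Qed.

Section Orbit.
Context {R : realType} {X : Type} {s : R} {p : X -> X -> R}.
Hypotheses (hs : 1 <= s) (hp : partial_bmetric s p).

Lemma pbm_eq0 (x y : X) : p x y = 0 -> x = y.
Proof.
move=> pxy; apply/(pbm_eq hp).
have [x0 xle] := pbm_self hp x y; have [y0 yle] := pbm_self hp y x.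
by rewrite (pbm_sym hp y x) in yle; split; lra.
Qed.

Lemma pbm_weak_triangle (x y z : X) : p x y <= s * (p x z + p z y).
Proof.
by have := pbm_triangle hp x y z; have := pbm_ge0 hp z z; lra.
Qed.

(** Each added index costs a factor [s] in the constant, so [D] depends on [N]; this serves for gaps
    of bounded length only. *)
Lemma geometric_near (x_ : nat -> X) (k C : R) (N : nat) :
  0 <= k -> k < 1 -> 0 <= C ->
  (forall n, p (x_ n) (x_ n.+1) <= C * k ^+ n) ->
  exists2 D, 0 <= D &
    forall m n, (m <= N)%N -> p (x_ n) (x_ (n + m)%N) <= D * k ^+ n.
Proof.
move=> k0 k1 C0 hd; elim: N => [|N [D D0 IH]].
  (* Even gap 0 needs (pm2), since self-distances may be positive. *)
  exists C => // -[] // n _; rewrite addn0.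
  exact: le_trans (pbm_self hp (x_ n) (x_ n.+1)).2 (hd n).
have sD : D + C <= s * (D + C) by rewrite ler_peMl ?addr_ge0.
exists (s * (D + C)); first lra.
move=> m n; rewrite leq_eqVlt => /orP[/eqP->|]; last first.
  rewrite ltnS => /IH-/(_ n)/le_trans; apply.
  by rewrite ler_wpM2r ?exprn_ge0 //; lra.
apply: le_trans (pbm_weak_triangle _ _ (x_ (n + N)%N)) _.
rewrite -mulrA ler_wpM2l ?(le_trans ler01) // mulrDl lerD ?IH // addnS.
apply: le_trans (hd _) _.
by rewrite ler_wpM2l // ler_wiXn2l ?leq_addr // ltW.
Qed.

Lemma geometric_tail (x_ : nat -> X) (k C : R) :
  0 <= k -> k < 1 -> 0 <= C ->
  (forall n, p (x_ n) (x_ n.+1) <= C * k ^+ n) ->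
  exists2 M, 0 <= M & forall m n, p (x_ n) (x_ (n + m)%N) <= M * k ^+ n.
Proof.
move=> k0 k1 C0 hd; have s0 : 0 < s := lt_le_trans ltr01 hs.
have [N hN] : exists N, s * k ^+ N <= 2^-1.
  have kabs : `|k| < 1 by rewrite ger0_norm.
  have /cvgrPdist_le /(_ (s^-1 / 2)) := cvg_expr kabs.
  have e0 : 0 < s^-1 / 2 by rewrite divr_gt0 ?invr_gt0.
  move=> /(_ e0)[N _ /(_ N (leqnn N))]; rewrite /= sub0r normrN.
  rewrite ger0_norm ?exprn_ge0 // => h; exists N.
  by rewrite mulrC -ler_pdivlMr // mulrC.
have [D D0 hD] := geometric_near x_ k C N k0 k1 C0 hd.
have sD : D <= s * D by rewrite ler_peMl.
(* This is the solution of [M = s * D + M / 2]: a jump of [N] indices costs [s * D], and the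
   remaining gap costs [s * k ^+ N * M <= M / 2]. *)
exists (2 * (s * D)); first lra.
elim/ltn_ind => m IH n.
have kn0 : 0 <= k ^+ n by rewrite exprn_ge0.
case: (leqP m N) => [/hD-/(_ n)/le_trans|Nm].
  by apply; rewrite ler_wpM2r //; lra.
(* [N = 0] would give [s <= 1 / 2]; a positive [N] makes the gap decrease. *)
case: N => [|N] in hN hD Nm *; first by move: hN hs; rewrite expr0; lra.
apply: le_trans (pbm_weak_triangle _ _ (x_ (n + N.+1)%N)) _.
have /IH/(_ (n + N.+1)%N) : (m - N.+1 < m)%N.
  by rewrite ltn_subrL /= (leq_trans _ Nm).
rewrite -addnA subnKC ?(ltnW Nm) // exprD => h2.
have h1 := hD N.+1 n (leqnn _).
apply: (@le_trans _ _
  (s * (D * k ^+ n + 2 * (s * D) * (k ^+ n * k ^+ N.+1)))).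
  by rewrite ler_wpM2l ?(ltW s0) // lerD.
have w0 : 0 <= 2 * (s * D) * k ^+ n by rewrite mulr_ge0 //; lra.
by have := ler_wpM2l w0 hN; lra.
Qed.

Lemma geometric_zero_cauchy (x_ : nat -> X) (k C : R) :
  0 <= k -> k < 1 -> 0 <= C ->
  (forall n, p (x_ n) (x_ n.+1) <= C * k ^+ n) -> zero_cauchy p x_.
Proof.
move=> k0 k1 C0 /(geometric_tail _ _ _ k0 k1 C0)[M M0 hM].
have cvk : (M * k ^+ n @[n --> \oo] --> (0 : R))%classic.
  rewrite -[X in (_ --> X)%classic](mulr0 M); apply: cvgMl_tmp; apply: cvg_expr.
  by rewrite ger0_norm.
(* The sum dominates the tail bound whichever index is smaller, and each summand depends on one
   index only. *)
apply: (@squeeze_cvgr _ _ _ _ (fun=> 0)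
    (fun nm : nat * nat => M * k ^+ nm.1 + M * k ^+ nm.2)).
- apply: nearW => -[n m] /=; rewrite (pbm_ge0 hp) /=.
  have n0 : 0 <= M * k ^+ n by rewrite mulr_ge0 ?exprn_ge0.
  have m0 : 0 <= M * k ^+ m by rewrite mulr_ge0 ?exprn_ge0.
  case: (leqP n m) => [nm|/ltnW mn].
    by have := hM (m - n)%N n; rewrite subnKC //; lra.
  by have := hM (n - m)%N m; rewrite subnKC // (pbm_sym hp); lra.
- exact: cvg_cst.
- rewrite -[X in (_ --> X)%classic](addr0 0); apply: cvgD.
    exact: cvg_comp cvg_fst cvk.
  exact: cvg_comp cvg_snd cvk.
Qed.

End Orbit.

Theorem theorem3p4 (R : realType) (X : Type) (s : R) (p : X -> X -> R)
    (T : X -> X) (l1 l2 l3 l4 l5 : R)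
    (hX : inhabited X)
    (hs : 1 <= s)
    (hp : partial_bmetric s p)
    (hcomplete : zero_complete p)
    (hl1 : 0 <= l1) (hl2 : 0 <= l2) (hl3 : 0 <= l3) (hl4 : 0 <= l4)
    (hl5 : 0 <= l5)
    (hl : l1 + l2 + 2 * s * l3 + s * l4 + s * l5 < 1)
    (hT : forall x y : X,
      p (T x) (T y) <=
        l1 * p x y
        + l2 * ((p x (T x) * p y (T y)) / (1 + p x y))
        + l3 * ((p x (T y) * p y (T x)) / (1 + p x y))
        + l4 * ((p x (T x) * p x (T y)) / (1 + p x y))
        + l5 * ((p y (T y) * p y (T x)) / (1 + p x y))) :
  exists u : X,
    [/\ T u = u, forall v : X, T v = v -> v = u & p u u = 0].
Proof.
have s0 : 0 <= s by lra.
have p0 := pbm_ge0 hp.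
have sl3 : l3 <= s * l3 by rewrite ler_peMl.
have sl4 : l4 <= s * l4 by rewrite ler_peMl.
have sl5 : l5 <= s * l5 by rewrite ler_peMl.
have [x0] := hX; pose x_ n := iter n T x0.
(* [A / B] is the ratio given by [orbit_step]; [A < B] is exactly the coefficient condition. *)
pose A := l1 + s * l3 + s * (l4 + l5) / 2.
pose B := 1 - l2 - s * l3 - s * (l4 + l5) / 2.
have A0 : 0 <= A by rewrite /A; lra.
have AB : A < B by rewrite /A /B; lra.
have B0 : 0 < B by lra.
have k0 : 0 <= A / B by rewrite divr_ge0 // ltW.
have k1 : A / B < 1 by rewrite ltr_pdivrMr // mul1r.
have step x : p (T x) (T (T x)) <= A / B * p x (T x).
  rewrite mulrAC ler_pdivlMr // mulrC.
  have := hT (T x) x; rewrite (pbm_sym hp (T (T x))) (pbm_sym hp (T x) x).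
  have [_ ea] := pbm_self hp (T x) x; rewrite (pbm_sym hp (T x) x) in ea.
  have [_ eb] := pbm_self hp (T x) (T (T x)).
  move=> h2; apply: orbit_step (hT x (T x)) h2 => //.
  exact: pbm_triangle.
have hd n : p (x_ n) (x_ n.+1) <= p x0 (T x0) * (A / B) ^+ n.
  elim: n => [|n IH]; first by rewrite expr0 mulr1.
  by apply: le_trans (step _) _; rewrite exprS mulrCA ler_wpM2l.
have hc := geometric_zero_cauchy hs hp x_ _ _ k0 k1 (p0 _ _) hd.
have [u [_ hu puu]] := hcomplete x_ hc.
set D := p u (T u).
have D0 : 0 <= D by exact: p0.
(* [K] collects the bounds obtained by passing from [u] to [T u] through a late iterate: every term
   has a factor at most [e], and [e <= 1] bounds [p (x_ n) (T u)] by [s * (1 + D)]. As [K] does not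
   depend on [e], [D] must vanish. *)
pose K := s * (1 + l1 + l2 * D + l3 * (s * (1 + D)) + l4 * (s * (1 + D))
               + l5 * D).
have hK e : 0 < e -> e <= 1 -> D <= K * e.
  move=> e0 e1.
  have cvd : (p x0 (T x0) * (A / B) ^+ n @[n --> \oo] --> (0 : R))%classic.
    rewrite -[X in (_ --> X)%classic](mulr0 (p x0 (T x0))).
    by apply: cvgMl_tmp; apply: cvg_expr; rewrite ger0_norm.
  move/cvgrPdist_le: hu => /(_ _ e0)[N1 _ h1].
  move/cvgrPdist_le: cvd => /(_ _ e0)[N2 _ h2].
  pose n := maxn N1 N2.
  have an m : (n <= m)%N -> p (x_ m) u <= e.
    move=> nm; have := h1 m (leq_trans (leq_maxl _ _) nm).
    by rewrite /= sub0r normrN ger0_norm.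
  have dn : p (x_ n) (x_ n.+1) <= e.
    apply: le_trans (hd n) _; have := h2 n (leq_maxr _ _).
    by rewrite /= sub0r normrN; apply: le_trans; exact: ler_norm.
  have a0 := an n (leqnn n); have a1 := an n.+1 (leqnSn n).
  have cS : p (x_ n) (T u) <= s * (1 + D).
    apply: le_trans (pbm_weak_triangle hp _ _ u) _.
    by rewrite ler_wpM2l // lerD2r; lra.
  have h := hT (x_ n) u; rewrite -[T (x_ n)]/(x_ n.+1) -/D in h.
  rewrite (pbm_sym hp u (x_ n.+1)) in h.
  have t1 : l1 * p (x_ n) u <= l1 * e by rewrite ler_wpM2l.
  have t2 : l2 * (p (x_ n) (x_ n.+1) * D / (1 + p (x_ n) u)) <= l2 * (e * D).
    by rewrite ler_wpM2l // (le_trans (divr_le_prod _ _ _ _ _ _ _)) //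
      ler_wpM2r.
  have t3 : l3 * (p (x_ n) (T u) * p (x_ n.+1) u / (1 + p (x_ n) u))
      <= l3 * (s * (1 + D) * e).
    by rewrite ler_wpM2l // (le_trans (divr_le_prod _ _ _ _ _ _ _)) //
      ler_pM.
  have t4 : l4 * (p (x_ n) (x_ n.+1) * p (x_ n) (T u) / (1 + p (x_ n) u))
      <= l4 * (e * (s * (1 + D))).
    by rewrite ler_wpM2l // (le_trans (divr_le_prod _ _ _ _ _ _ _)) //
      ler_pM.
  have t5 : l5 * (D * p (x_ n.+1) u / (1 + p (x_ n) u)) <= l5 * (D * e).
    by rewrite ler_wpM2l // (le_trans (divr_le_prod _ _ _ _ _ _ _)) //
      ler_wpM2l.
  apply: le_trans (pbm_weak_triangle hp _ _ (x_ n.+1)) _.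
  rewrite /K -mulrA ler_wpM2l // (pbm_sym hp u).
  lra.
have uD : p u (T u) = 0.
  apply/eqP; rewrite eq_le p0 andbT -/D.
  have K0 : 0 <= K by have := hK 1 ltr01 (lexx _); lra.
  apply/ler_addgt0Pl => e e0; rewrite addr0.
  have m0 : 0 < Num.min 1 (e / (K + 1)).
    by rewrite lt_min ltr01 divr_gt0 //; lra.
  apply: le_trans (hK _ m0 _) _; first by rewrite ge_min lexx.
  apply: (@le_trans _ _ (K * (e / (K + 1)))).
    by rewrite ler_wpM2l // ge_min lexx orbT.
  rewrite mulrA ler_pdivrMr; last by lra.
  by lra.
have Tu : T u = u by rewrite -(pbm_eq0 hp _ _ uD).
exists u; split => // v Tv.
apply/esym/(pbm_eq0 hp).
(* [p u u = 0] kills the [l2] and [l4] terms. The self-distance [p v v] is only known to be at most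
   [p u v], which leaves [p u v <= (l1 + l3 + l5) * p u v]. *)
have := hT u v; rewrite Tu Tv puu !mul0r !mulr0 !addr0 (pbm_sym hp v u).
have q0 := p0 u v.
have vq : p v v <= p u v by have := (pbm_self hp v u).2; rewrite (pbm_sym hp v).
have t3 : l3 * (p u v * p u v / (1 + p u v)) <= l3 * p u v.
  by rewrite ler_wpM2l // divr_le_factor //; lra.
have t5 : l5 * (p v v * p u v / (1 + p u v)) <= l5 * p u v.
  by rewrite ler_wpM2l // divr_le_factor //; lra.
move=> h.
have : 0 <= (1 - l1 - l3 - l5) * - p u v by lra.
rewrite pmulr_rge0; last by lra.
by lra.
Qed.
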